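(* Let $D,T$ be the unitary operators on $L^2(\mathbb{R})$ given by $(Tf)(t)=f(t-1)$ and $(Df)(t)=\sqrt{2}f(2t)$, let $\mathcal{F}$ be the Fourier–Plancherel transform on $L^2(\mathbb{R})$, and put $\widehat{D}=\mathcal{F}D\mathcal{F}^{-1}$, $\widehat{T}=\mathcal{F}T\mathcal{F}^{-1}$. Then the commutant of $\{\widehat D,\widehat T\}$ is $$\{\widehat D,\widehat T\}'=\{M_h : h\in L^\infty(\mathbb{R}) \text{ and } h(s)=h(2s) \text{ for a.e. } s\in\mathbb{R}\},$$ where $M_h$ denotes the multiplication operator $f\mapsto hf$.
   Context: The Fourier–Plancherel transform is normalized so that for $f\in L^1(\mathbb{R})\cap L^2(\mathbb{R})$, $(\mathcal{F}f)(s)=\frac{1}{\sqrt{2\pi}}\int_{\mathbb{R}}e^{-ist}f(t)\,dt$, extended to a unitary on $L^2(\mathbb{R})$ (Lebesgue measure). The commutant $\mathcal{S}'$ of a set $\mathcal{S}$ of bounded operators is the set of bounded operators commuting with every element of $\mathcal{S}$. *)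

(* Defs.v *)
From HB Require Import structures.
From mathcomp Require Import all_boot all_order all_algebra.
From mathcomp Require Import all_classical all_reals all_analysis.
From mathcomp Require Import complex.
Set Implicit Arguments. Unset Strict Implicit. Unset Printing Implicit Defensive.
Import Order.TTheory GRing.Theory Num.Theory.
Local Open Scope classical_set_scope.
Local Open Scope ring_scope.

(* Complex numbers are [R[i]] (real_closed/complex).
   Functions R -> R[i] are representatives of elements of L^2(R) (Lebesgue
   measure); operators are maps on representatives, considered modulo
   a.e. equality on square-integrable inputs. *)

Section Defs.
Variable R : realType.
Local Notation C := (R[i]).
Local Notation leb := (@lebesgue_measure R).

Definition cabs2 (z : C) : R := complex.Re z ^+ 2 + complex.Im z ^+ 2.

Definition measC (f : R -> C) : Prop :=
  measurable_fun setT (fun x => complex.Re (f x)) /\ measurable_fun setT (fun x => complex.Im (f x)).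

Definition isL2 (f : R -> C) : Prop :=
  measC f /\ (\int[leb]_x ((cabs2 (f x))%:E) < +oo)%E.

Definition isL1 (f : R -> C) : Prop :=
  measC f /\ (\int[leb]_x ((Num.sqrt (cabs2 (f x)))%:E) < +oo)%E.

Definition isLinf (h : R -> C) : Prop :=
  measC h /\ exists M : R, {ae leb, forall x, cabs2 (h x) <= M}.

Definition aeeq (f g : R -> C) : Prop := {ae leb, forall x, f x = g x}.

Definition cint (f : R -> C) : C :=
  Complex (Rintegral leb setT (fun x => complex.Re (f x)))
          (Rintegral leb setT (fun x => complex.Im (f x))).

Definition expmi (u : R) : C := Complex (cos u) (- sin u).

Definition opL2 := (R -> C) -> (R -> C).

Definition bounded_op (A : opL2) : Prop :=
  [/\ (forall f, isL2 f -> isL2 (A f)),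
      (forall f g, isL2 f -> isL2 g -> aeeq f g -> aeeq (A f) (A g)),
      (forall (c : C) f g, isL2 f -> isL2 g ->
          aeeq (A (fun x => c * f x + g x)) (fun x => c * A f x + A g x)) &
      exists M : R, forall f, isL2 f ->
          (\int[leb]_x ((cabs2 (A f x))%:E) <=
           M%:E * \int[leb]_x ((cabs2 (f x))%:E))%E].

Definition op_eq (A B : opL2) : Prop := forall f, isL2 f -> aeeq (A f) (B f).

Definition op_comp (A B : opL2) : opL2 := fun f => A (B f).

Definition commutes (A B : opL2) : Prop := op_eq (op_comp A B) (op_comp B A).

(* F is the Fourier-Plancherel transform: the bounded operator on L^2(R)
   given on L^1 \cap L^2 by (F f)(s) = 1/sqrt(2 pi) \int e^{-ist} f(t) dt.
   (By density of L^1 \cap L^2 this determines F uniquely on L^2.) *)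
Definition is_fourier_plancherel (F : opL2) : Prop :=
  bounded_op F /\
  forall f, isL1 f -> isL2 f ->
    aeeq (F f) (fun s => (Num.sqrt (2 * pi))^-1%:C%C * cint (fun t => expmi (s * t) * f t)).

Definition is_inverse_op (F Finv : opL2) : Prop :=
  bounded_op Finv /\ op_eq (op_comp F Finv) id /\ op_eq (op_comp Finv F) id.

Definition transl_op : opL2 := fun f t => f (t - 1).
Definition dil_op : opL2 := fun f t => (Num.sqrt 2)%:C%C * f (2 * t).

Definition mult_op (h : R -> C) : opL2 := fun f s => h s * f s.

End Defs.

(* Main.v *)
(** Conjugation by the Fourier transform turns the translation into the
    multiplication by [e^{-is}] and the dilation into the dilation by [1/2];
    both identities are computed on [L^1 \cap L^2] and extended by density.

    An operator [B] commuting with both commutes with the multiplications by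
    [e^{-is/2^n}], hence by [sin (2^-n (s - a))].  The set of bounded functions
    whose multiplication operator commutes with [B] is an algebra closed under
    bounded pointwise limits.  Iterating [x (3 - x^2) / 2] gives the sign of
    [sin (2^-n (s - a))], which tends to the sign of [s - a]; so the algebra
    contains the indicators of half-lines, of Borel sets, and finally every
    bounded Borel function.  Therefore [B] is the multiplication by [B g / g]
    for any strictly positive [g] in [L^2] (here the square root of a Gaussian
    density), and commutation with the dilation gives the invariance of [B g / g]. *)
Require Import Defs.
From HB Require Import structures.
From mathcomp Require Import all_boot all_order all_algebra.
From mathcomp Require Import all_classical all_reals all_analysis.
From mathcomp Require Import complex ring lra measurable_realfun.
Set Implicit Arguments. Unset Strict Implicit. Unset Printing Implicit Defensive.
Import Order.TTheory GRing.Theory Num.Theory.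
Import numFieldNormedType.Exports.
Local Open Scope classical_set_scope.
Local Open Scope ring_scope.

(** * Squared modulus of complex numbers and the characters $e^{-iu}$ *)

Section ComplexModulus.
Variable R : realType.
Implicit Types z w : R[i].

Lemma complex_ReM z w :
  complex.Re (z * w) = complex.Re z * complex.Re w - complex.Im z * complex.Im w.
Proof. by case: z; case: w. Qed.

Lemma complex_ImM z w :
  complex.Im (z * w) = complex.Re z * complex.Im w + complex.Im z * complex.Re w.
Proof. by case: z; case: w. Qed.

Lemma cabs2_ge0 z : 0 <= cabs2 z.
Proof. by rewrite /cabs2 addr_ge0 ?sqr_ge0. Qed.

Lemma cabs2_eq0 z : cabs2 z = 0 -> z = 0.
Proof.
case: z => a b; rewrite /cabs2 /= => /eqP.
by rewrite paddr_eq0 ?sqr_ge0// !sqrf_eq0 => /andP[/eqP-> /eqP->].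
Qed.

Lemma cabs2M z w : cabs2 (z * w) = cabs2 z * cabs2 w.
Proof. by rewrite /cabs2 complex_ReM complex_ImM; ring. Qed.

(** By the parallelogram law the two sides differ by $|z-w|^2$. This stands in for the triangle
    inequality while keeping square roots out of the estimates. *)
Lemma cabs2D_le z w : cabs2 (z + w) <= 2 * cabs2 z + 2 * cabs2 w.
Proof.
case: z => a b; case: w => c d; rewrite /cabs2 /=.
by rewrite -subr_ge0 (_ : _ - _ = (a - c) ^+ 2 + (b - d) ^+ 2) ?addr_ge0 ?sqr_ge0//; ring.
Qed.

Lemma cabs2_real (r : R) : cabs2 r%:C%C = r ^+ 2.
Proof. by rewrite /cabs2 /= expr0n /= addr0. Qed.

Lemma cabs2N1 : cabs2 (-1 : R[i]) = 1.
Proof. by rewrite /cabs2 /=; ring. Qed.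

Lemma cabs2_expmi (u : R) : cabs2 (expmi u) = 1.
Proof. by rewrite /cabs2 /= sqrrN cos2Dsin2. Qed.

Lemma expmiD (u v : R) : expmi (u + v) = expmi u * expmi v.
Proof.
rewrite /expmi; apply/eqP; rewrite eq_complex/=; apply/andP; split; apply/eqP.
  by rewrite cosD; ring.
by rewrite sinD; ring.
Qed.

Lemma expmiN (u : R) : expmi u * expmi (- u) = 1.
Proof. by rewrite -expmiD subrr /expmi cos0 sin0 oppr0. Qed.

End ComplexModulus.

(** * Square-integrable functions and almost-everywhere equality *)

Section SquareIntegrable.
Variable R : realType.
Local Notation C := R[i].
Local Notation leb := (@lebesgue_measure R).
Implicit Types (f g h : R -> C) (u : R -> R) (P Q : R -> Prop).

(* [x : R] ranges over the carrier of a different (but convertible) canonical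
   measurable type than the one on which [leb] lives, so the [Filter] instance
   has to be given by hand. *)
Lemma ae_impl P Q : (forall x, P x -> Q x) ->
  {ae leb, forall x, P x} -> {ae leb, forall x, Q x}.
Proof. exact: (@filterS _ _ (ae_filter_ringOfSetsType leb) P Q). Qed.

Lemma ae_impl2 P Q (S : R -> Prop) : (forall x, P x -> Q x -> S x) ->
  {ae leb, forall x, P x} -> {ae leb, forall x, Q x} -> {ae leb, forall x, S x}.
Proof. exact: (@filterS2 _ _ (ae_filter_ringOfSetsType leb) P Q S). Qed.

Lemma ae_impl3 P Q (S U : R -> Prop) : (forall x, P x -> Q x -> S x -> U x) ->
  {ae leb, forall x, P x} -> {ae leb, forall x, Q x} -> {ae leb, forall x, S x} ->
  {ae leb, forall x, U x}.
Proof. exact: (@filterS3 _ _ (ae_filter_ringOfSetsType leb) P Q S U). Qed.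

Lemma measurable_EFin u :
  measurable_fun setT u -> measurable_fun setT (fun x => (u x)%:E).
Proof. by move=> mu; apply/measurable_EFinP. Qed.

Lemma measurable_sqr u :
  measurable_fun setT u -> measurable_fun setT (fun x => u x ^+ 2).
Proof. exact: measurable_funX. Qed.

Definition sqnorm f : \bar R := (\int[leb]_x (cabs2 (f x))%:E)%E.

Lemma measC_cst (c : C) : measC (fun=> c : C).
Proof. by split; exact: measurable_cst. Qed.

Lemma measC_real u : measurable_fun setT u -> measC (fun x => (u x)%:C%C).
Proof. by move=> mu; split => //=; exact: measurable_cst. Qed.

Lemma measCD f g : measC f -> measC g -> measC (fun x => f x + g x).
Proof.
move=> [f1 f2] [g1 g2]; split.
  rewrite (_ : (fun _ => _) = (fun x => complex.Re (f x) + complex.Re (g x))).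
    exact: measurable_funD.
  by apply/funext => x; case: (f x); case: (g x).
rewrite (_ : (fun _ => _) = (fun x => complex.Im (f x) + complex.Im (g x))).
  exact: measurable_funD.
by apply/funext => x; case: (f x); case: (g x).
Qed.

Lemma measCM f g : measC f -> measC g -> measC (fun x => f x * g x).
Proof.
move=> [f1 f2] [g1 g2]; split.
  under eq_fun do rewrite complex_ReM.
  by apply: measurable_funB; exact: measurable_funM.
under eq_fun do rewrite complex_ImM.
by apply: measurable_funD; exact: measurable_funM.
Qed.

Lemma measurable_cabs2 f : measC f -> measurable_fun setT (fun x => cabs2 (f x)).
Proof. by move=> [f1 f2]; apply: measurable_funD; exact: measurable_funX. Qed.

Lemma measurable_cabs2_EFin f :
  measC f -> measurable_fun setT (fun x => (cabs2 (f x))%:E).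
Proof. by move=> /measurable_cabs2 mf; exact: measurable_EFin mf. Qed.

Lemma measC_expmi (r : R) : measC (fun x => expmi (r * x)).
Proof.
have mr : measurable_fun setT (fun x : R => r * x) by exact: measurable_funM.
split => /=.
  apply: (measurableT_comp _ mr); exact: continuous_measurable_fun (@continuous_cos R).
apply: measurableT_comp => //; apply: (measurableT_comp _ mr).
exact: continuous_measurable_fun (@continuous_sin R).
Qed.

Lemma sqnorm_ge0 f : (0 <= sqnorm f)%E.
Proof. by apply: integral_ge0 => x _; rewrite lee_fin cabs2_ge0. Qed.

Lemma sqnorm_fin f : isL2 f -> sqnorm f \is a fin_num.
Proof. by move=> [_ fi]; rewrite ge0_fin_numE// sqnorm_ge0. Qed.

Lemma ae_sqnorm_le f g : measC f -> measC g ->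
  {ae leb, forall x, cabs2 (f x) <= cabs2 (g x)} -> (sqnorm f <= sqnorm g)%E.
Proof.
move=> mf mg fg; apply: ae_ge0_le_integral => //=.
- by move=> x _; rewrite lee_fin cabs2_ge0.
- exact: measurable_cabs2_EFin.
- by move=> x _; rewrite lee_fin cabs2_ge0.
- exact: measurable_cabs2_EFin.
- by apply: ae_impl fg => x fg _; rewrite lee_fin.
Qed.

Lemma aeeq_sqnorm f g : measC f -> measC g -> aeeq f g -> sqnorm f = sqnorm g.
Proof.
move=> mf mg fg; apply/eqP; rewrite eq_le; apply/andP.
by split; apply: ae_sqnorm_le => //; apply: ae_impl fg => x ->.
Qed.

Lemma sqnormZ (c : C) f : measC f ->
  sqnorm (fun x => c * f x) = ((cabs2 c)%:E * sqnorm f)%E.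
Proof.
move=> mf; rewrite /sqnorm.
under eq_integral do rewrite cabs2M EFinM.
rewrite ge0_integralZl//; first exact: measurable_cabs2_EFin.
  by move=> x _; rewrite lee_fin cabs2_ge0.
by rewrite lee_fin cabs2_ge0.
Qed.

Lemma sqnormD_le f g : measC f -> measC g ->
  (sqnorm (fun x => f x + g x)%R <= 2%:E * sqnorm f + 2%:E * sqnorm g)%E.
Proof.
move=> mf mg; rewrite /sqnorm -!ge0_integralZl//; last 4 first.
- exact: measurable_cabs2_EFin.
- by move=> x _; rewrite lee_fin cabs2_ge0.
- exact: measurable_cabs2_EFin.
- by move=> x _; rewrite lee_fin cabs2_ge0.
have m2 (k : R -> C) : measC k -> measurable_fun setT (fun x => 2%:E * (cabs2 (k x))%:E)%E.
  move=> mk; apply: (@measurable_EFin (fun x => 2 * cabs2 (k x))).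
  by apply: measurable_funM => //; exact: measurable_cabs2 mk.
rewrite -ge0_integralD//; last 4 first.
- by move=> x _; rewrite -EFinM lee_fin mulr_ge0// cabs2_ge0.
- exact: m2.
- by move=> x _; rewrite -EFinM lee_fin mulr_ge0// cabs2_ge0.
- exact: m2.
apply: ge0_le_integral => //=.
- by move=> x _; rewrite lee_fin cabs2_ge0.
- exact: measurable_cabs2_EFin (measCD mf mg).
- by apply: emeasurable_funD; exact: m2.
- by move=> x _; rewrite -!EFinM -EFinD lee_fin cabs2D_le.
Qed.

Lemma sqnorm_eq0 f : measC f -> (sqnorm f <= 0)%E -> aeeq f (fun=> 0).
Proof.
move=> mf f0.
have /(ae_eq_integral_abs leb measurableT (measurable_cabs2_EFin mf)) :
    (\int[leb]_(x in setT) `|(cabs2 (f x))%:E| = 0)%E.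
  apply/eqP; rewrite eq_le; apply/andP; split; last exact: integral_ge0.
  apply: le_trans f0; rewrite /sqnorm le_eqVlt; apply/orP; left; apply/eqP.
  by apply: eq_integral => x _; rewrite gee0_abs// lee_fin cabs2_ge0.
by apply: ae_impl => x /(_ I) /= [] /cabs2_eq0.
Qed.

Lemma isL2Z (c : C) f : isL2 f -> isL2 (fun x => c * f x).
Proof.
move=> f2; have [mf fi] := f2; split; first exact: measCM (measC_cst c) mf.
rewrite -/(sqnorm _) sqnormZ// lte_mul_pinfty ?lee_fin ?cabs2_ge0//.
Qed.

Lemma isL2D f g : isL2 f -> isL2 g -> isL2 (fun x => f x + g x).
Proof.
move=> f2 g2; have [mf fi] := f2; have [mg gi] := g2; split; first exact: measCD.
apply: le_lt_trans (sqnormD_le mf mg) _.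
by apply: lte_add_pinfty; rewrite lte_mul_pinfty.
Qed.

Lemma isL2ZD (c : C) f g : isL2 f -> isL2 g -> isL2 (fun x => c * f x + g x).
Proof. by move=> f2 g2; apply: isL2D => //; exact: isL2Z. Qed.

Lemma sqnorm_mulinf h f (M : R) : measC h -> measC f ->
  {ae leb, forall x, cabs2 (h x) <= M} ->
  (sqnorm (fun x => h x * f x)%R <= (Num.max M 0)%:E * sqnorm f)%E.
Proof.
move=> mh mf hM; have M0 : 0 <= Num.max M 0 by rewrite le_max lexx orbT.
have cM : cabs2 ((Num.sqrt (Num.max M 0))%:C%C : C) = Num.max M 0.
  by rewrite cabs2_real sqr_sqrtr.
rewrite -[X in (X%:E * _)%E]cM -sqnormZ//; apply: ae_sqnorm_le.
- exact: measCM.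
- exact: measCM (measC_cst _) mf.
- apply: ae_impl hM => x hM; rewrite !cabs2M cM ler_wpM2r ?cabs2_ge0//.
  by rewrite le_max hM.
Qed.

Lemma isL2_mulinf h f : isLinf h -> isL2 f -> isL2 (fun x => h x * f x).
Proof.
move=> [mh [M hM]] [mf fi]; split; first exact: measCM.
apply: le_lt_trans (sqnorm_mulinf mh mf hM) _.
by rewrite lte_mul_pinfty// lee_fin le_max lexx orbT.
Qed.

Lemma aeeq_sym f g : aeeq f g -> aeeq g f.
Proof. by apply: ae_impl => x ->. Qed.

Lemma aeeq_trans f g h : aeeq f g -> aeeq g h -> aeeq f h.
Proof. by apply: ae_impl2 => x -> ->. Qed.

Lemma aeeq_mull h f g : aeeq f g -> aeeq (fun x => h x * f x) (fun x => h x * g x).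
Proof. by apply: ae_impl => x ->. Qed.

(** Serves the density and limit arguments: the squared norm of the fixed function $f-g$ lies below
    a null sequence, so it vanishes. The difference is written [-1 * g x + f x] to have the shape of
    the linearity clause of [bounded_op]. *)
Lemma aeeq_limit f g (K : R) (e : nat -> \bar R) : measC f -> measC g ->
  (forall n, (sqnorm (fun x => -1 * g x + f x)%R <= K%:E * e n)%E) ->
  e @ \oo --> 0%E -> aeeq f g.
Proof.
move=> mf mg fg e0.
have md : measC (fun x => -1 * g x + f x) by exact: measCD (measCM (measC_cst _) mg) mf.
have : aeeq (fun x => -1 * g x + f x) (fun=> 0).
  apply: sqnorm_eq0 => //.
  have : (K%:E * e n)%E @[n --> \oo] --> (K%:E * 0)%E by apply: cvgeZl.
  by rewrite mule0; apply: cvge_ge; apply: nearW => n; exact: fg.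
by apply: ae_impl => x /eqP; rewrite mulN1r addrC subr_eq0 => /eqP.
Qed.

(** Dominated convergence with integrable majorant $K^2|f|^2$. *)
Lemma cvg_sqnorm_mul (u : nat -> R -> R) (K : R) f : isL2 f ->
  (forall n, measurable_fun setT (u n)) -> (forall n x, `|u n x| <= K) ->
  (forall x, u n x @[n --> \oo] --> (0 : R)) ->
  sqnorm (fun x => (u n x)%:C%C * f x) @[n --> \oo] --> 0%E.
Proof.
move=> f2 mu uK u0; have [mf fi] := f2.
have K0 : 0 <= K by apply: le_trans (uK 0%N 0); exact: normr_ge0.
have := @dominated_convergence _ _ R leb setT measurableT
  (fun n x => (u n x ^+ 2 * cabs2 (f x))%:E) (cst 0%E)
  (fun x => (K ^+ 2 * cabs2 (f x))%:E).
move=> /(_ _ _ _ _ _)[].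
- move=> n; apply/measurable_EFinP/measurable_funM; last exact: measurable_cabs2.
  exact: (@measurable_sqr (u n)).
- exact: measurable_cst.
- apply: aeW => x _; apply/fine_cvgP; split; first exact: nearW.
  rewrite /= (_ : 0 = 0 * 0 * cabs2 (f x)); last by rewrite !mul0r.
  apply: cvgM; last exact: cvg_cst.
  by under eq_fun do rewrite /= expr2; apply: cvgM; exact: u0.
- apply/integrableP; split.
    apply: (@measurable_EFin (fun x => K ^+ 2 * cabs2 (f x))).
    by apply: measurable_funM => //; exact: measurable_cabs2 mf.
  have -> : (\int[leb]_x `|(K ^+ 2 * cabs2 (f x))%:E| = (K ^+ 2)%:E * sqnorm f)%E.
    rewrite /sqnorm -ge0_integralZl//; last 3 first.
    + exact: measurable_cabs2_EFin.
    + by move=> x _; rewrite lee_fin cabs2_ge0.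
    + by rewrite lee_fin sqr_ge0.
    by apply: eq_integral => x _; rewrite gee0_abs ?EFinM// lee_fin mulr_ge0 ?sqr_ge0 ?cabs2_ge0.
  by rewrite lte_mul_pinfty ?lee_fin ?sqr_ge0.
- apply: aeW => x n _; rewrite gee0_abs lee_fin; last by rewrite mulr_ge0 ?sqr_ge0 ?cabs2_ge0.
  by rewrite ler_wpM2r ?cabs2_ge0// -real_normK ?num_real// ler_sqr ?nnegrE.
move=> _ _; rewrite integral0.
under [X in X @ _ --> _ -> _]eq_fun do under eq_integral do rewrite -cabs2_real -cabs2M.
exact.
Qed.

End SquareIntegrable.

(** * Affine changes of variable with positive slope *)

Section AffineSubstitution.
Variable R : realType.
Local Notation C := R[i].
Local Notation leb := (@lebesgue_measure R).
Variables (a b : R).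
Hypothesis a0 : 0 < a.

Let phi : measurableTypeR R -> measurableTypeR R := fun x => a * x + b.

Lemma measurable_affine : measurable_fun setT (fun x : R => a * x + b).
Proof. by apply: measurable_funD => //; exact: measurable_funM. Qed.

Let mphi : measurable_fun setT phi. Proof. exact: measurable_affine. Qed.

Let nu := mscale (NngNum (ltW a0))
  (measure_function_pushforward__canonical__measure_function_Measure leb mphi).

(** The measure [nu], which is $a$ times the image of Lebesgue measure under [phi], gives every
    interval $]c,d]$ its length; uniqueness of Lebesgue measure extends the agreement to all
    measurable sets. *)
Lemma lebesgue_measure_affine (A : set R) : measurable A ->
  (leb A = a%:E * leb ((fun x => a * x + b)%R @^-1` A))%E.
Proof.
move=> mA.
transitivity (nu A); last by [].
apply: lebesgue_measure_unique => //= _ [[c d]] _ <-.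
rewrite /nu /mscale /= /pushforward.
have -> : phi @^-1` `]c, d] = `](c - b) / a, (d - b) / a]%classic.
  apply/seteqP; split => x /=; rewrite !in_itv/= /phi ltr_pdivrMr// ler_pdivlMr//
    ltrBlDr lerBrDr (mulrC x a) //.
rewrite !lebesgue_measure_itv/= !lte_fin ltr_pM2r ?invr_gt0// ltrD2r.
case: ifPn => cd; last by rewrite mule0.
rewrite -!EFinB -EFinM; congr (_%:E).
by rewrite -mulrBl mulrCA divff ?gt_eqF//; ring.
Qed.

Lemma ge0_integral_affine (f : R -> \bar R) : measurable_fun setT f ->
  (forall x, 0 <= f x)%E ->
  (\int[leb]_x f x = a%:E * \int[leb]_x f (a * x + b)%R)%E.
Proof.
move=> mf f0.
rewrite (eq_measure_integral nu); last first.
  by move=> A mA _; exact: lebesgue_measure_affine.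
rewrite ge0_integral_mscale//=; congr (_ * _)%E.
by rewrite ge0_integral_pushforward.
Qed.

Lemma Rintegral_affine (f : R -> R) : measurable_fun setT f ->
  Rintegral leb setT f = a * Rintegral leb setT (fun x => f (a * x + b)).
Proof.
move=> mf.
have mEf : measurable_fun setT (EFin \o f) by exact/measurable_EFinP.
rewrite /Rintegral.
have -> : (\int[leb]_x (f x)%:E = a%:E * \int[leb]_x (f (a * x + b))%:E)%E.
  rewrite integralE (ge0_integral_affine (f := (EFin \o f)^\+%E)); last 2 first.
  - exact: measurable_funepos.
  - by move=> x; rewrite funepos_ge0.
  rewrite (ge0_integral_affine (f := (EFin \o f)^\-%E)); last 2 first.
  - exact: measurable_funeneg.
  - by move=> x; rewrite funeneg_ge0.
  rewrite [X in _ = (_ * X)%E]integralE.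
  (* Multiplication by $a > 0$ fixes both infinities, so it distributes over the difference of the
     positive and negative parts even when these are infinite. *)
  have mulaB (p q : \bar R) : (a%:E * p - a%:E * q = a%:E * (p - q))%E.
    case: p => [p||]; case: q => [q||] //=; rewrite ?(gt0_muley, gt0_muleNy) ?lte_fin//=.
    by rewrite -!EFinM -!EFinB mulrBr.
  by rewrite mulaB; congr (_ * (_ - _))%E; apply: eq_integral => x _; rewrite ?funeposE ?funenegE.
(* [fine] sends both infinities to 0, a convention compatible with multiplication by $a$. *)
have fineaM (p : \bar R) : fine (a%:E * p)%E = a * fine p.
  by case: p => [p||] //=; rewrite ?(gt0_muley, gt0_muleNy) ?lte_fin//= mulr0.
by rewrite fineaM.
Qed.

(** The preimage of a null set is null, because $a \neq 0$ times its measure is 0. *)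
Lemma ae_affine (P : R -> Prop) : {ae leb, forall x, P x} ->
  {ae leb, forall x, P (a * x + b)}.
Proof.
move=> [N [mN N0 PN]]; exists (phi @^-1` N); split => //.
- by rewrite -[X in measurable X]setTI; exact: mphi.
- have := lebesgue_measure_affine mN; rewrite N0 => /esym/eqP.
  by rewrite mule_eq0 eqe gt_eqF//= => /eqP.
- by move=> x /= Px; exact: PN.
Qed.

Lemma measC_affine (f : R -> C) : measC f -> measC (fun x => f (a * x + b)).
Proof.
move=> [f1 f2]; split.
  exact: (measurableT_comp f1 measurable_affine).
exact: (measurableT_comp f2 measurable_affine).
Qed.

Lemma sqnorm_affine (f : R -> C) : measC f ->
  (sqnorm (fun x => f (a * x + b)%R) = (a^-1)%:E * sqnorm f)%E.
Proof.
move=> mf; rewrite {2}/sqnorm ge0_integral_affine; last 2 first.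
- exact: measurable_cabs2_EFin.
- by move=> x; rewrite lee_fin cabs2_ge0.
by rewrite muleA -EFinM mulVf ?gt_eqF// mul1e.
Qed.

Lemma cint_affine (f : R -> C) : measC f ->
  cint f = a%:C%C * cint (fun x => f (a * x + b)).
Proof.
move=> [f1 f2]; rewrite /cint (Rintegral_affine f1) (Rintegral_affine f2).
by apply/eqP; rewrite eq_complex/= !mul0r subr0 addr0 !eqxx.
Qed.

Lemma isL1_affine (c : C) (f : R -> C) : isL1 f -> isL1 (fun x => c * f (a * x + b)).
Proof.
move=> [mf fi].
have mg : measurable_fun setT (fun x => (Num.sqrt (cabs2 (f x)))%:E).
  apply/measurable_EFinP; apply: measurableT_comp; last exact: measurable_cabs2.
  exact: continuous_measurable_fun (@sqrt_continuous R).
have mf' := measC_affine mf.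
split; first exact: measCM (measC_cst c) mf'.
under eq_integral do rewrite cabs2M sqrtrM ?cabs2_ge0// EFinM.
rewrite ge0_integralZl_EFin//; last exact: (measurableT_comp mg measurable_affine).
rewrite lte_mul_pinfty ?lee_fin ?sqrtr_ge0//.
(* After substitution the integral for $f$ is $a > 0$ times the integral of the composed function,
   so an infinite value of the latter would make the former infinite. *)
move: fi; rewrite (ge0_integral_affine mg); last by move=> x; rewrite lee_fin sqrtr_ge0.
apply: contraTT; rewrite -!leNgt !leye_eq => /eqP ->.
by rewrite gt0_muley ?lte_fin.
Qed.

(** Covers the translation, the dilation and the dilation by $1/2$ at once. *)
Lemma bounded_affine_op (c : C) : bounded_op (fun (f : R -> C) x => c * f (a * x + b)).
Proof.
have bd (f : R -> C) : measC f ->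
    (sqnorm (fun x => c * f (a * x + b)%R)%R = (cabs2 c * a^-1)%:E * sqnorm f)%E.
  by move=> mf; rewrite (@sqnormZ _ c (fun x => f (a * x + b))) ?sqnorm_affine ?muleA//; exact: measC_affine.
split.
- move=> f [mf fi]; split; first exact: measCM (measC_cst c) (measC_affine mf).
  rewrite -/(sqnorm _) bd// lte_mul_pinfty//.
  by rewrite lee_fin mulr_ge0 ?cabs2_ge0// invr_ge0 ltW.
- move=> f g _ _ /ae_affine; apply: ae_impl => x -> //.
- by move=> k f g _ _; apply: aeW => x; ring.
- by exists (cabs2 c * a^-1) => f [mf _]; rewrite -/(sqnorm _) bd.
Qed.

End AffineSubstitution.

(** * Bounded operators, multiplication operators and density of $L^1 \cap L^2$ *)

Section BoundedOperators.
Variable R : realType.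
Local Notation C := R[i].
Local Notation leb := (@lebesgue_measure R).
Implicit Types (A B : opL2 R) (f g h : R -> C) (u : R -> R).

Lemma bounded_op_comp A B : bounded_op A -> bounded_op B -> bounded_op (op_comp A B).
Proof.
move=> [A2 Aae Alin [M AM]] [B2 Bae Blin [N BN]]; split.
- by move=> f f2; apply/A2/B2.
- by move=> f g f2 g2 fg; apply: Aae; [exact: B2|exact: B2|exact: Bae].
- move=> c f g f2 g2; apply: aeeq_trans (Alin c _ _ (B2 _ f2) (B2 _ g2)).
  by apply: Aae; [apply/B2/isL2ZD|apply/isL2ZD; exact: B2|exact: Blin].
- exists (Num.max M 0 * N) => f f2; apply: le_trans (AM _ (B2 _ f2)) _.
  rewrite EFinM -muleA; apply: (@le_trans _ _ ((Num.max M 0)%:E * sqnorm (B f))%E).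
    by apply: lee_wpmul2r; rewrite ?sqnorm_ge0// lee_fin le_max lexx.
  by apply: lee_wpmul2l; [rewrite lee_fin le_max lexx orbT|exact: BN].
Qed.

Lemma bounded_mult_op h : isLinf h -> bounded_op (mult_op h).
Proof.
move=> hinf; have [mh [M hM]] := hinf; split.
- by move=> f; exact: isL2_mulinf.
- by move=> f g _ _; exact: aeeq_mull.
- by move=> c f g _ _; apply: aeW => x; rewrite /mult_op; ring.
- by exists (Num.max M 0) => f [mf _]; exact: sqnorm_mulinf.
Qed.

Lemma bounded_op_bound A : bounded_op A -> exists M : R, 0 <= M /\ forall f, isL2 f ->
  (sqnorm (A f) <= M%:E * sqnorm f)%E.
Proof.
move=> [_ _ _ [M AM]]; exists (Num.max M 0); split; first by rewrite le_max lexx orbT.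
move=> f f2; apply: le_trans (AM f f2) _.
by apply: lee_wpmul2r; rewrite ?sqnorm_ge0// lee_fin le_max lexx.
Qed.

Lemma isL2_op A f : bounded_op A -> isL2 f -> isL2 (A f).
Proof. by move=> [+ _ _ _]; exact. Qed.

Lemma aeeq_op A f g : bounded_op A -> isL2 f -> isL2 g -> aeeq f g -> aeeq (A f) (A g).
Proof. by move=> [_ + _ _]; exact. Qed.

Lemma op_linear A (c : C) f g : bounded_op A -> isL2 f -> isL2 g ->
  aeeq (A (fun x => c * f x + g x)) (fun x => c * A f x + A g x).
Proof. by move=> [_ _ + _]; exact. Qed.

Lemma commutes_congr A A' B : bounded_op A -> bounded_op A' -> bounded_op B ->
  op_eq A A' -> commutes B A -> commutes B A'.
Proof.
move=> bA bA' bB AA BA f f2.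
apply: (@aeeq_trans _ _ (B (A f))).
  exact: (aeeq_op bB (isL2_op bA' f2) (isL2_op bA f2) (aeeq_sym (AA f f2))).
apply: aeeq_trans (BA f f2) _.
by apply: AA; exact: isL2_op.
Qed.

Definition bounded_measurable u :=
  measurable_fun setT u /\ exists K : R, forall x, `|u x| <= K.

Lemma isLinf_real u : bounded_measurable u -> isLinf (fun x => (u x)%:C%C).
Proof.
move=> [mu [K uK]]; split; first exact: measC_real.
exists (K ^+ 2); apply: aeW => x; rewrite cabs2_real.
have K0 : 0 <= K by apply: le_trans (uK 0); exact: normr_ge0.
by rewrite -real_normK ?num_real// ler_sqr ?nnegrE.
Qed.

Lemma isL2_mulreal u f : bounded_measurable u -> isL2 f -> isL2 (fun x => (u x)%:C%C * f x).
Proof. by move=> /isLinf_real; exact: isL2_mulinf. Qed.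

Definition truncation (n : nat) : R -> R := \1_`[- n%:R, n%:R].

Lemma truncation_bounded n : bounded_measurable (truncation n).
Proof.
split; first exact: measurable_indic.
by exists 1 => x; rewrite /truncation indicE; case: (_ \in _); rewrite ?normr1 ?normr0.
Qed.

(** On $[-n,n]$ one has $|f| \le 1 + |f|^2$, and the constant 1 is integrable there since the
    interval has finite length. *)
Lemma isL1_truncation n f : isL2 f -> isL1 (fun x => (truncation n x)%:C%C * f x).
Proof.
move=> f2; have [mf fi] := f2; have [mt _] := truncation_bounded n.
have mtf := measCM (measC_real mt) mf.
split => //.
apply: (@le_lt_trans _ _ (\int[leb]_x ((truncation n x)%:E + (cabs2 (f x))%:E))%E).
  apply: ge0_le_integral => //=.
  - apply: measurable_EFin; apply: (measurableT_comp _ (measurable_cabs2 mtf)).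
    exact: continuous_measurable_fun (@sqrt_continuous R).
  - apply: (@measurable_EFin _ (fun x => truncation n x + cabs2 (f x))).
    by apply: measurable_funD => //; exact: measurable_cabs2 mf.
  - move=> x _; rewrite -EFinD lee_fin cabs2M cabs2_real /truncation indicE.
    case: (_ \in _); last by rewrite expr0n/= mul0r sqrtr0 add0r cabs2_ge0.
    rewrite expr1n mul1r; set s := Num.sqrt _.
    rewrite -(sqr_sqrtr (cabs2_ge0 (f x))) -/s.
    have le1 (y : R) : y <= 1 + y ^+ 2.
      by rewrite expr2; have := sqr_ge0 (y - 1); rewrite expr2; nra.
    exact: le1.
rewrite ge0_integralD//=.
- have -> : (\int[leb]_x (truncation n x)%:E = leb `[(- n%:R)%R, n%:R%R]%classic)%E.
    by rewrite /truncation integral_indic// setIT.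
  rewrite lebesgue_measure_itv/=; apply: lte_add_pinfty => //.
  by case: ifPn => // _; rewrite -EFinD ltry.
- by move=> x _; rewrite lee_fin /truncation.
- exact: measurable_EFin.
- by move=> x _; rewrite lee_fin cabs2_ge0.
- exact: measurable_cabs2_EFin.
Qed.

Lemma truncation_cvg x : truncation n x @[n --> \oo] --> (1 : R).
Proof.
apply: cvg_near_cst; near=> n.
rewrite /truncation indicE mem_set//= in_itv/= -ler_norml.
by near: n; exact: nbhs_infty_ger.
Unshelve. all: by end_near. Qed.

(** Write $f$ as its truncation [t n], which lies in $L^1 \cap L^2$, plus a remainder [r n] that
    tends to 0 in $L^2$. The operators agree on [t n], so $Af - Bf = A(r_n) - B(r_n)$ almost
    everywhere, and boundedness makes this tend to 0. *)
Lemma op_eq_L1L2 A B : bounded_op A -> bounded_op B ->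
  (forall f, isL1 f -> isL2 f -> aeeq (A f) (B f)) -> op_eq A B.
Proof.
move=> bA bB AB f f2.
have [M [M0 AM]] := bounded_op_bound bA; have [N [N0 BN]] := bounded_op_bound bB.
have Af2 := isL2_op bA f2; have Bf2 := isL2_op bB f2.
pose t n := fun x => (truncation n x)%:C%C * f x.
pose r n := fun x => (1 - truncation n x)%:C%C * f x.
have bt n := truncation_bounded n.
have br n : bounded_measurable (fun x => 1 - truncation n x).
  have [mt _] := bt n; split; first exact: measurable_funB.
  exists 1 => x; rewrite /truncation indicE.
  by case: (_ \in _); rewrite ?subrr ?subr0 ?normr1 ?normr0.
have t2 n : isL2 (t n) by exact: isL2_mulreal.
have r2 n : isL2 (r n) by exact: isL2_mulreal.
have split_f n : f = (fun x => 1 * t n x + r n x).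
  by apply/funext => x; rewrite /t /r rmorphB/=; ring.
(* The factors 2 come from [sqnormD_le]; $N$ and $M$ are the bounds of [B] and [A]. *)
apply: (@aeeq_limit _ _ _ (2 * N + 2 * M) (fun n => sqnorm (r n))).
- by case: Af2.
- by case: Bf2.
- move=> n.
  have Ar2 := isL2_op bA (r2 n); have Br2 := isL2_op bB (r2 n).
  have [mAr _] := Ar2; have [mBr _] := Br2.
  have <- : sqnorm (fun x => (-1) * B (r n) x + A (r n) x) =
            sqnorm (fun x => (-1) * B f x + A f x).
    apply: aeeq_sqnorm; [by case: (isL2ZD (-1) Br2 Ar2)|by case: (isL2ZD (-1) Bf2 Af2)|].
    have EA := op_linear 1 bA (t2 n) (r2 n); have EB := op_linear 1 bB (t2 n) (r2 n).
    rewrite -split_f in EA; rewrite -split_f in EB.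
    have ABt := AB _ (isL1_truncation n f2) (t2 n).
    by apply: ae_impl3 ABt EA EB => x; rewrite -/(t n) => tE -> ->; rewrite tE; ring.
  have mN := measCM (measC_cst (-1)) mBr.
  apply: le_trans (sqnormD_le mN mAr) _; rewrite sqnormZ// cabs2N1 mul1e.
  have -> : ((2 * N + 2 * M)%:E * sqnorm (r n) =
      2%:E * (N%:E * sqnorm (r n)) + 2%:E * (M%:E * sqnorm (r n)))%E.
    by rewrite !muleA -!EFinM -ge0_muleDl ?lee_fin ?mulr_ge0.
  by apply: leeD; apply: lee_wpmul2l => //; [exact: BN|exact: AM].
- apply: (@cvg_sqnorm_mul _ (fun n x => 1 - truncation n x) 1) => //.
  + by move=> n; have [] := br n.
  + move=> n x; rewrite /truncation indicE.
    by case: (_ \in _); rewrite ?subrr ?subr0 ?normr1 ?normr0.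
  + move=> x; rewrite -(subrr 1); apply: cvgB; [exact: cvg_cst|exact: truncation_cvg].
Qed.

End BoundedOperators.

(** * Conjugates of translation and dilation under the Fourier transform *)

Section FourierConjugates.
Variable R : realType.
Local Notation C := R[i].
Local Notation leb := (@lebesgue_measure R).
Implicit Types (A B : opL2 R) (f g h : R -> C) (u : R -> R).

Lemma isL1_integrable f : isL1 f ->
  leb.-integrable setT (EFin \o (fun x => complex.Re (f x))) /\
  leb.-integrable setT (EFin \o (fun x => complex.Im (f x))).
Proof.
move=> [mf fi]; have [f1 f2] := mf.
have msq : measurable_fun setT (fun x => (Num.sqrt (cabs2 (f x)))%:E).
  apply: measurable_EFin; apply: (measurableT_comp _ (measurable_cabs2 mf)).
  exact: continuous_measurable_fun (@sqrt_continuous R).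
have i (u : R -> R) : measurable_fun setT u ->
    (forall x, u x ^+ 2 <= cabs2 (f x)) -> leb.-integrable setT (EFin \o u).
  move=> mu uf; apply/integrableP; split; first exact: measurable_EFin mu.
  apply: le_lt_trans fi; apply: ge0_le_integral => //=.
  - exact: measurable_EFin (measurableT_comp (@normr_measurable R setT) mu).
  - by move=> x _; rewrite lee_fin -sqrtr_sqr ler_wsqrtr.
by split; apply: i => // x; rewrite /cabs2 ?lerDl ?lerDr sqr_ge0.
Qed.

Lemma cintZ (c : C) f : isL1 f -> cint (fun x => c * f x) = c * cint f.
Proof.
move=> /isL1_integrable[i1 i2]; rewrite /cint.
have iZ (k : R) (u : R -> R) : leb.-integrable setT (EFin \o u) ->
    leb.-integrable setT (EFin \o (fun x => k * u x)).
  by move=> iu; exact: (integrableZl measurableT k iu).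
under eq_Rintegral do rewrite complex_ReM.
rewrite RintegralB//; [|exact: iZ|exact: iZ].
under [X in Complex _ X]eq_Rintegral do rewrite complex_ImM.
rewrite RintegralD//; [|exact: iZ|exact: iZ].
by rewrite !RintegralZl//; case: c.
Qed.

Lemma isL1_expmi (s : R) f : isL1 f -> isL1 (fun t => expmi (s * t) * f t).
Proof.
move=> [mf fi]; split; first exact: measCM (measC_expmi s) mf.
by under eq_integral do rewrite cabs2M cabs2_expmi mul1r.
Qed.

Lemma transl_opE : @transl_op R = (fun f x => 1 * f (1 * x + -1)).
Proof. by apply/funext => f; apply/funext => x; rewrite !mul1r. Qed.

Lemma dil_opE : @dil_op R = (fun f x => (Num.sqrt 2)%:C%C * f (2 * x + 0)).
Proof. by apply/funext => f; apply/funext => x; rewrite addr0. Qed.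

(** The inverse of [dil_op], since $\sqrt2/2 = 1/\sqrt2$. The summand [0] keeps the affine shape
    used by the substitution lemmas. *)
Definition half_dil_op : opL2 R :=
  fun f x => (Num.sqrt 2 / 2)%:C%C * f (2^-1 * x + 0).

Lemma bounded_transl_op : bounded_op (@transl_op R).
Proof. by rewrite transl_opE; exact: bounded_affine_op. Qed.

Lemma bounded_dil_op : bounded_op (@dil_op R).
Proof. by rewrite dil_opE; exact: bounded_affine_op. Qed.

Lemma bounded_half_dil_op : bounded_op half_dil_op.
Proof. by apply: bounded_affine_op; rewrite invr_gt0. Qed.

Lemma isLinf_expmi (r : R) : isLinf (fun x => expmi (r * x)).
Proof.
split; first exact: measC_expmi.
by exists 1; apply: aeW => x; rewrite cabs2_expmi.
Qed.

Lemma fourier_transl F : is_fourier_plancherel F ->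
  op_eq (op_comp F (@transl_op R)) (op_comp (mult_op (fun s => expmi (1 * s))) F).
Proof.
move=> [bF Ff]; apply: op_eq_L1L2.
- exact: bounded_op_comp bounded_transl_op.
- exact: bounded_op_comp (bounded_mult_op (isLinf_expmi _)) bF.
move=> f f1 f2; have [mf _] := f2.
have Tf1 : isL1 (transl_op f) by rewrite transl_opE; exact: isL1_affine.
have Tf2 := isL2_op bounded_transl_op f2; have [mTf _] := Tf2.
apply: ae_impl2 (Ff f f1 f2) (Ff _ Tf1 Tf2) => s; rewrite /op_comp /mult_op => -> ->.
rewrite mulrCA; congr (_ * _).
(* Substituting $t = x + 1$ removes the shift from $f$ and splits off the factor $e^{-is}$ from
   $e^{-is(x+1)}$. *)
rewrite (@cint_affine R 1 1 ltr01 _ (measCM (measC_expmi s) mTf)) mul1r mul1r.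
rewrite -(cintZ _ (isL1_expmi s f1)); congr (cint _); apply/funext => x.
by rewrite /transl_op mul1r addrK mulrDr mulr1 expmiD; ring.
Qed.

Lemma fourier_dil F : is_fourier_plancherel F ->
  op_eq (op_comp F (@dil_op R)) (op_comp half_dil_op F).
Proof.
move=> [bF Ff]; apply: op_eq_L1L2.
- exact: bounded_op_comp bounded_dil_op.
- exact: bounded_op_comp bounded_half_dil_op bF.
move=> f f1 f2; have [mf _] := f2.
have Df1 : isL1 (dil_op f) by rewrite dil_opE; exact: isL1_affine.
have Df2 := isL2_op bounded_dil_op f2.
have h0 : 0 < 2^-1 :> R by rewrite invr_gt0.
(* The integral formula for $Ff$ is needed at $s/2$, where it still holds for almost every $s$. *)
have := ae_affine 0 h0 (Ff f f1 f2).
apply: ae_impl2 (Ff _ Df1 Df2) => s; rewrite /op_comp /half_dil_op => -> ->.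
rewrite mulrCA; congr (_ * _); rewrite addr0.
have mG := measCM (measC_cst (Num.sqrt 2)%:C%C) (measCM (measC_expmi (2^-1 * s)) mf).
(* Substituting $t = 2x$ in the integral for $(Ff)(s/2)$ turns $e^{-ist/2} f(t)$ into $e^{-isx}
   f(2x)$; the Jacobian 2 cancels the denominator of $\sqrt2/2$. *)
have := @cint_affine R 2 0 (ltr0Sn _ 1) _ mG.
rewrite (cintZ _ (isL1_expmi _ f1)) => E.
rewrite [(_ / 2)%:C%C]rmorphM/= mulrAC E mulrAC -rmorphM/= divff ?pnatr_eq0// mul1r; congr (cint _); apply/funext => x.
rewrite /dil_op addr0 mulrCA (_ : 2^-1 * s * (2 * x) = s * x)//.
by field.
Qed.

(** Apply the intertwining relation $FA = A'F$ to $F^{-1}f$ and cancel $F F^{-1}$ inside [A']. *)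
Lemma conjugate_op_eq F Finv A A' : bounded_op F -> is_inverse_op F Finv ->
  bounded_op A' -> op_eq (op_comp F A) (op_comp A' F) ->
  op_eq (op_comp F (op_comp A Finv)) A'.
Proof.
move=> bF [bFi [FFi _]] bA' FA f f2.
have g2 := isL2_op bFi f2; apply: aeeq_trans (FA _ g2) _.
exact: (aeeq_op bA' (isL2_op bF g2) f2 (FFi f f2)).
Qed.

End FourierConjugates.

(** * Polynomial iteration converging to the sign *)

Section SignIteration.
Variable R : realType.

(* On [[-1, 1]] the iterates of this polynomial converge to the sign function. *)
Definition sign_step (x : R) : R := 2^-1 * (x * (3 + -1 * (x * x))).

Lemma iter_sign_stepN k x : iter k sign_step (- x) = - iter k sign_step x.
Proof. by elim: k => //= k ->; rewrite /sign_step; field. Qed.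

Lemma iter_sign_step0 k : iter k sign_step 0 = 0.
Proof. by elim: k => //= k ->; rewrite /sign_step mul0r mulr0. Qed.

(** With $p$ the step polynomial, $p(y) - y = y(1-y)(1+y)/2 \ge 0$ shows that the iterates never
    drop below $x$. Also $1 - p(y) = (1-y) \cdot (1-y)(2+y)/2$, where the last factor is at most $1
    - y/2 \le 1 - x/2$; so the distance to 1 decays geometrically. *)
Lemma iter_sign_step_pos k x : 0 < x <= 1 ->
  x <= iter k sign_step x <= 1 /\ 1 - iter k sign_step x <= (1 - x / 2) ^+ k.
Proof.
move=> /andP[x0 x1]; elim: k => [|k [/andP[xy y1] yk]] /=.
  by rewrite lexx x1 expr0; split => //; lra.
move: (iter k sign_step x) xy y1 yk => y xy y1 yk; rewrite /sign_step exprS.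
have y0 : 0 < y by exact: lt_le_trans xy.
have E : 1 - 2^-1 * (y * (3 + -1 * (y * y))) = (1 - y) * ((1 - y) * (2 + y) / 2) by field.
have E' : 2^-1 * (y * (3 + -1 * (y * y))) - y = y * (1 - y) * (1 + y) / 2 by field.
split; [apply/andP; split|].
- rewrite (le_trans xy)// -subr_ge0 E'; apply: divr_ge0 => //.
  by rewrite !mulr_ge0 ?subr_ge0// ?ltW// addr_gt0.
- rewrite -subr_ge0 E; apply: mulr_ge0; first by rewrite subr_ge0.
  by apply: divr_ge0 => //; rewrite mulr_ge0 ?subr_ge0// addr_ge0// ltW.
- rewrite E mulrC; apply: ler_pM => //; last by nra.
  + by apply: divr_ge0 => //; rewrite mulr_ge0 ?subr_ge0// addr_ge0// ltW.
  + by rewrite subr_ge0.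
Qed.

Lemma iter_sign_step_cvg x : `|x| <= 1 -> iter k sign_step x @[k --> \oo] --> Num.sg x.
Proof.
have pos y : 0 < y <= 1 -> iter k sign_step y @[k --> \oo] --> (1 : R).
  move=> /[dup] y01 /andP[y0 y1].
  have geo : (1 - (1 - y / 2) ^+ k) @[k --> \oo] --> (1 : R).
    rewrite -[X in _ --> X]subr0; apply: cvgB; first exact: cvg_cst.
    by apply: cvg_expr; rewrite ger0_norm; lra.
  apply: (squeeze_cvgr _ geo (cvg_cst _)); apply: nearW => k.
  by have [/andP[_ ->] ?] := iter_sign_step_pos k y01; rewrite andbT; lra.
move=> x1; have [x0|x0|->] := ltgtP x 0.
- rewrite ltr0_sg//; rewrite (_ : (fun k => iter k sign_step x) = (fun k => - iter k sign_step (- x))).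
    2: by apply/funext => k; rewrite iter_sign_stepN opprK.
  by apply: cvgN; apply: pos; rewrite oppr_gt0 x0 -ltr0_norm.
- by rewrite gtr0_sg//; apply: pos; rewrite x0 -(gtr0_norm x0).
- rewrite sgr0 (_ : (fun _ => _) = cst 0); first exact: cvg_cst.
  by apply/funext => k; rewrite iter_sign_step0.
Qed.

Lemma iter_sign_step_bound k x : `|x| <= 1 -> `|iter k sign_step x| <= 1.
Proof.
have pos y : 0 < y <= 1 -> `|iter k sign_step y| <= 1.
  move=> /[dup] y01 /andP[y0 y1].
  have [/andP[yi i1] _] := iter_sign_step_pos k y01.
  by rewrite ger0_norm// (le_trans (ltW y0)).
move=> x1; have [x0|x0|->] := ltgtP x 0.
- by rewrite -[x]opprK iter_sign_stepN normrN; apply: pos; rewrite oppr_gt0 x0 -ltr0_norm.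
- by apply: pos; rewrite x0 -(gtr0_norm x0).
- by rewrite iter_sign_step0 normr0.
Qed.

End SignIteration.

(** * The algebra of bounded functions whose multiplication operator commutes with [B] *)

Section MultiplierAlgebra.
Variable R : realType.
Local Notation C := R[i].
Local Notation leb := (@lebesgue_measure R).
Variable B : opL2 R.
Hypothesis bB : bounded_op B.
Implicit Types (f g phi psi : R -> C) (u v : R -> R).

Definition multiplier phi := isLinf phi /\ commutes B (mult_op phi).

Lemma isL2_mult phi f : isLinf phi -> isL2 f -> isL2 (mult_op phi f).
Proof. by move=> phi_inf; apply: isL2_op; exact: bounded_mult_op. Qed.

Lemma multiplier_cst (c : C) : multiplier (fun=> c).
Proof.
split.
  by split; [exact: measC_cst|exists (cabs2 c); exact: aeW].
(* Linearity is available in the form $cf + g$, so $cf$ is written as $(c-1)f + f$. *)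
move=> f f2; have := op_linear (c - 1) bB f2 f2.
rewrite (_ : (fun x => (c - 1) * f x + f x) = mult_op (fun=> c) f).
  by apply: ae_impl => x; rewrite /op_comp /mult_op => ->; ring.
by apply/funext => x; rewrite /mult_op; ring.
Qed.

Lemma multiplierD phi psi : multiplier phi -> multiplier psi ->
  multiplier (fun x => phi x + psi x).
Proof.
move=> [phi_inf Bphi] [psi_inf Bpsi]; split.
  have [mphi [M phiM]] := phi_inf; have [mpsi [N psiN]] := psi_inf.
  split; first exact: measCD.
  exists (2 * M + 2 * N); apply: ae_impl2 phiM psiN => x xM xN.
  by apply: le_trans (cabs2D_le _ _) _; apply: lerD; rewrite ler_wpM2l.
move=> f f2; have phif2 := isL2_mult phi_inf f2; have psif2 := isL2_mult psi_inf f2.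
have := op_linear 1 bB phif2 psif2.
rewrite (_ : (fun x => 1 * mult_op phi f x + mult_op psi f x)
           = mult_op (fun x => phi x + psi x) f).
  apply: ae_impl3 (Bphi f f2) (Bpsi f f2) => x; rewrite /op_comp /mult_op => -> -> ->.
  by ring.
by apply/funext => x; rewrite /mult_op; ring.
Qed.

Lemma multiplierM phi psi : multiplier phi -> multiplier psi ->
  multiplier (fun x => phi x * psi x).
Proof.
move=> [phi_inf Bphi] [psi_inf Bpsi]; split.
  have [mphi [M phiM]] := phi_inf; have [mpsi [N psiN]] := psi_inf.
  split; first exact: measCM.
  exists (M * N); apply: ae_impl2 phiM psiN => x xM xN.
  by rewrite cabs2M ler_pM ?cabs2_ge0.
move=> f f2; have psif2 := isL2_mult psi_inf f2.
have -> : op_comp B (mult_op (fun x => phi x * psi x)) f = B (mult_op phi (mult_op psi f)).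
  by rewrite /op_comp; congr B; apply/funext => x; rewrite /mult_op mulrA.
apply: ae_impl2 (Bphi _ psif2) (Bpsi f f2) => x; rewrite /op_comp /mult_op => -> ->.
by rewrite mulrA.
Qed.

(** Commutation with [phi] at $\psi f$ reads $Bf = \varphi B(\psi f)$; multiplying by [psi] gives
    the claim. *)
Lemma multiplier_inv phi psi : isLinf psi -> (forall x, phi x * psi x = 1) ->
  multiplier phi -> multiplier psi.
Proof.
move=> psi_inf pp [phi_inf Bphi]; split => // f f2.
have psif2 := isL2_mult psi_inf f2.
have := Bphi _ psif2.
have -> : op_comp B (mult_op phi) (mult_op psi f) = B f.
  by rewrite /op_comp; congr B; apply/funext => x; rewrite /mult_op mulrA pp mul1r.
apply: ae_impl => x; rewrite /op_comp /mult_op => ->.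
by rewrite mulrA [psi x * _]mulrC pp mul1r.
Qed.

(** With $d_n = v - u_n$, commutation with $u_n$ gives $B(vf) - vBf = B(d_n f) - d_n Bf$. Both terms
    on the right tend to 0 in $L^2$: $d_n f$ and $d_n Bf$ by dominated convergence, and then $B(d_n
    f)$ by boundedness of [B]. *)
Lemma multiplier_lim (u : nat -> R -> R) v (K : R) :
  (forall n, measurable_fun setT (u n)) -> (forall n x, `|u n x| <= K) ->
  (forall x, u n x @[n --> \oo] --> v x) ->
  (forall n, multiplier (fun x => (u n x)%:C%C)) -> multiplier (fun x => (v x)%:C%C).
Proof.
move=> mu uK uv Bu.
have mv : measurable_fun setT v.
  by apply: (@measurable_fun_cvg _ _ R setT u) => // x _; exact: uv.
have vK x : `|v x| <= K.
  by apply: (@cvgr_to_le _ _ _ _ _ _ _ (cvg_norm (uv x))); apply: nearW => n; exact: uK.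
have bv : bounded_measurable v by split => //; exists K.
have v_inf := isLinf_real bv.
have bu n : bounded_measurable (u n) by split => //; exists K.
pose d n x := v x - u n x.
have md n : measurable_fun setT (d n) by exact: measurable_funB.
have dK n x : `|d n x| <= K + K by apply: le_trans (ler_normB _ _) _; apply: lerD.
have bd n : bounded_measurable (d n) by split => //; exists (K + K).
have d0 x : d n x @[n --> \oo] --> (0 : R).
  by rewrite -(subrr (v x)); apply: cvgB => //; exact: cvg_cst.
split => // f f2.
have Bf2 := isL2_op bB f2.
have vf2 := isL2_mult v_inf f2.
have Bvf2 := isL2_op bB vf2; have vBf2 := isL2_mult v_inf Bf2.
have [M [M0 BM]] := bounded_op_bound bB.
pose df n := fun x => (d n x)%:C%C * f x.
pose dBf n := fun x => (d n x)%:C%C * B f x.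
apply: (@aeeq_limit _ _ _ 1 (fun n => 2%:E * sqnorm (dBf n) + 2%:E * (M%:E * sqnorm (df n)))%E).
- by case: Bvf2.
- by case: vBf2.
- move=> n; rewrite mul1e.
  have df2 : isL2 (df n) by exact: isL2_mulreal.
  have dBf2 : isL2 (dBf n) by exact: isL2_mulreal.
  have uf2 : isL2 (mult_op (fun x => (u n x)%:C%C) f) by exact: isL2_mulreal.
  have Bdf2 := isL2_op bB df2.
  have [mdBf _] := dBf2; have [mBdf _] := Bdf2.
  have Z := isL2ZD (-1) dBf2 Bdf2.
  have <- : sqnorm (fun x => -1 * dBf n x + B (df n) x) =
     sqnorm (fun x => -1 * mult_op (fun x => (v x)%:C%C) (B f) x +
                      op_comp B (mult_op (fun x => (v x)%:C%C)) f x).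
    apply: aeeq_sqnorm; [by case: Z|by case: (isL2ZD (-1) vBf2 Bvf2)|].
    have E := op_linear 1 bB uf2 df2; have [_ /(_ f f2) Bun] := Bu n.
    rewrite (_ : (fun x => 1 * mult_op (fun x => (u n x)%:C%C) f x + df n x)
                = mult_op (fun x => (v x)%:C%C) f) in E; last first.
      by apply/funext => y; rewrite /mult_op /df /d rmorphB/=; ring.
    apply: ae_impl2 Bun E => x; rewrite /op_comp => Bx ->.
    by rewrite Bx /dBf /d /mult_op rmorphB/=; ring.
  apply: le_trans (sqnormD_le (measCM (measC_cst _) mdBf) mBdf) _.
  rewrite sqnormZ// cabs2N1 mul1e; apply: leeD => //.
  by apply: lee_wpmul2l => //; exact: BM.
- rewrite (_ : 0 = 2%:E * 0 + 2%:E * (M%:E * 0))%E; last by rewrite !mule0 adde0.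
  apply: cvgeD => //.
    by apply: cvgeZl => //; exact: cvg_sqnorm_mul d0.
  by apply: cvgeZl => //; apply: cvgeZl => //; exact: cvg_sqnorm_mul d0.
Qed.

(** If $D'$ denotes [half_dil_op], multiplication by $e^{-irx/2}$ after $D'$ equals $D'$ after
    multiplication by $e^{-irx}$. As $D'$ is onto and commutes with [B], commutation passes from
    frequency $r$ to $r/2$. *)
Lemma multiplier_expmi_half (r : R) : commutes B (@half_dil_op R) ->
  multiplier (fun x => expmi (r * x)) -> multiplier (fun x => expmi (r / 2 * x)).
Proof.
move=> BD [_ Be]; split; first exact: isLinf_expmi.
(* The preimage of $f$ under [half_dil_op]. *)
move=> f f2; pose g : R -> C := dil_op f.
have bD := bounded_half_dil_op R.
have g2 : isL2 g by exact: isL2_op (bounded_dil_op R) f2.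
have s2 : (Num.sqrt 2 / 2 * Num.sqrt 2 = 1 :> R).
  by rewrite mulrAC -expr2 sqr_sqrtr// divff.
have fE : half_dil_op g = f.
  apply/funext => x; rewrite /half_dil_op /g /dil_op addr0 mulrA -rmorphM s2 mul1r.
  by rewrite mulrA divff// mul1r.
have eg2 := isL2_mult (isLinf_expmi r) g2.
have Bg2 := isL2_op bB g2.
have eDE k : mult_op (fun x => expmi (r / 2 * x)) (half_dil_op k)
    = half_dil_op (mult_op (fun x => expmi (r * x)) k).
  by apply/funext => x; rewrite /mult_op /half_dil_op !addr0 mulrCA -[r / 2 * x]mulrA.
rewrite /op_comp -{1}fE eDE.
apply: aeeq_trans (BD _ eg2) _.
apply: aeeq_trans (aeeq_op bD (isL2_op bB eg2) (isL2_mult (isLinf_expmi r) Bg2) (Be g g2)) _.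
rewrite -eDE; apply: aeeq_mull; rewrite -[in X in aeeq _ X]fE.
exact/aeeq_sym/BD.
Qed.

(** * From exponentials to sines, signs and indicators *)

Hypothesis BD : commutes B (@half_dil_op R).
Hypothesis Be : commutes B (mult_op (fun x => expmi (1 * x))).

Lemma multiplier_expmi n : multiplier (fun x => expmi (2^-1 ^+ n * x)).
Proof.
elim: n => [|n IH]; first by rewrite expr0; split => //; exact: isLinf_expmi.
by rewrite exprSr; exact: multiplier_expmi_half.
Qed.

Lemma multiplier_cos_sin n :
  multiplier (fun x => (cos (2^-1 ^+ n * x))%:C%C) /\
  multiplier (fun x => (sin (2^-1 ^+ n * x))%:C%C).
Proof.
set r := 2^-1 ^+ n; have e1 := multiplier_expmi n; rewrite -/r in e1.
have e2 : multiplier (fun x => expmi (- r * x)).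
  apply: multiplier_inv e1 => [|x]; first exact: isLinf_expmi.
  by rewrite mulNr expmiN.
split.
  rewrite (_ : (fun _ => _) =
    (fun x => (2^-1)%:C%C * (expmi (r * x) + expmi (- r * x)))).
    exact: multiplierM (multiplier_cst _) (multiplierD e1 e2).
  apply/funext => x; rewrite [- r * x]mulNr /expmi cosN sinN.
  by apply/eqP; rewrite eq_complex/=; apply/andP; split; apply/eqP; field.
(* Since [expmi] is $e^{-iu}$, the sine is $\frac{i}{2}(e^{-iu} - e^{iu})$. *)
rewrite (_ : (fun _ => _) =
  (fun x => (Complex 0 2^-1) * (expmi (r * x) + (-1) * expmi (- r * x)))).
  apply: multiplierM (multiplier_cst _) (multiplierD e1 _).
  exact: multiplierM (multiplier_cst _) e2.
apply/funext => x; rewrite [- r * x]mulNr /expmi cosN sinN.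
by apply/eqP; rewrite eq_complex/=; apply/andP; split; apply/eqP; field.
Qed.

Lemma multiplier_sin_shift n (a : R) :
  multiplier (fun x => (sin (2^-1 ^+ n * (x - a)))%:C%C).
Proof.
have [c s] := multiplier_cos_sin n.
rewrite (_ : (fun _ => _) = (fun x =>
   (cos (2^-1 ^+ n * a))%:C%C * (sin (2^-1 ^+ n * x))%:C%C +
   (- sin (2^-1 ^+ n * a))%:C%C * (cos (2^-1 ^+ n * x))%:C%C)).
  apply: multiplierD; exact: multiplierM (multiplier_cst _) _.
by apply/funext => x; rewrite -!rmorphM -rmorphD/= mulrBr sinB; congr (_%:C%C); ring.
Qed.

Lemma multiplier_sg u : measurable_fun setT u -> (forall x, `|u x| <= 1) ->
  multiplier (fun x => (u x)%:C%C) -> multiplier (fun x => (Num.sg (u x))%:C%C).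
Proof.
move=> mu u1 Bu.
apply: (@multiplier_lim (fun k x => iter k (@sign_step R) (u x)) _ 1).
- elim=> [//|k IH] /=; rewrite /sign_step.
  apply: measurable_funM => //; apply: measurable_funM => //.
  by apply: measurable_funD => //; apply: measurable_funM => //; exact: measurable_funM.
- by move=> k x; exact: iter_sign_step_bound.
- by move=> x; exact: iter_sign_step_cvg.
- elim=> [//|k IH] /=; rewrite /sign_step.
  (* [sign_step] uses only constants, sums and products, with [-1 *] for subtraction, so the closure
     lemmas follow its shape. *)
  rewrite (_ : (fun _ => _) = (fun x => (2^-1)%:C%C * ((iter k (@sign_step R) (u x))%:C%C *
     (3%:C%C + (-1)%:C%C * ((iter k (@sign_step R) (u x))%:C%C * (iter k (@sign_step R) (u x))%:C%C))))).
    apply: multiplierM; first exact: multiplier_cst.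
    apply: multiplierM => //; apply: multiplierD; first exact: multiplier_cst.
    by apply: multiplierM; [exact: multiplier_cst|exact: multiplierM].
  by apply/funext => x; rewrite -!(rmorphM, rmorphD).
Qed.

Lemma multiplier_sg_shift (a : R) : multiplier (fun x => (Num.sg (x - a))%:C%C).
Proof.
have msin n : measurable_fun setT (fun x : R => sin (2^-1 ^+ n * (x - a))).
  apply: measurableT_comp; first exact: continuous_measurable_fun (@continuous_sin R).
  by apply: measurable_funM => //; exact: measurable_funB.
have sin1 n x : `|sin (2^-1 ^+ n * (x - a))| <= 1 :> R.
  by rewrite ler_norml sin_geN1 sin_le1.
have Bs n := multiplier_sg (msin n) (sin1 n) (multiplier_sin_shift n a).
apply: (@multiplier_lim (fun n x => Num.sg (sin (2^-1 ^+ n * (x - a)))) _ 1) => //.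
(* Measurability of the sign is read off the real part of the multiplier just obtained. *)
- move=> n; have [[[m _] _] _] := Bs n; exact: m.
- by move=> n x; rewrite normr_sg lern1; case: (_ != _).
(* For fixed $x$ the sequence is eventually constant: once $2^{-n}|x-a| < \pi$, the sine has the
   sign of $x - a$. *)
- move=> x; apply: cvg_near_cst.
  have [xa|xa|->] := ltgtP x a; last by apply: nearW => n; rewrite subrr mulr0 sin0.
  + have h : (2^-1 ^+ n * (a - x)) @[n --> \oo] --> (0 : R).
      rewrite -(mul0r (a - x)); apply: cvgM; last exact: cvg_cst.
      by apply: cvg_expr; rewrite ger0_norm; lra.
    have /cvgr_lt/(_ _ (pi_gt0 R)) := h.
    apply: filterS => n hn.
    rewrite -(opprB a x) mulrN sinN !sgrN; congr (- _).
    rewrite !gtr0_sg ?subr_gt0//; apply: sin_gt0_pi; rewrite hn andbT.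
    by rewrite mulr_gt0 ?subr_gt0// exprn_gt0.
  + have h : (2^-1 ^+ n * (x - a)) @[n --> \oo] --> (0 : R).
      rewrite -(mul0r (x - a)); apply: cvgM; last exact: cvg_cst.
      by apply: cvg_expr; rewrite ger0_norm; lra.
    have /cvgr_lt/(_ _ (pi_gt0 R)) := h.
    apply: filterS => n hn.
    rewrite !gtr0_sg ?subr_gt0//; apply: sin_gt0_pi; rewrite hn andbT.
    by rewrite mulr_gt0 ?subr_gt0// exprn_gt0.
Qed.

(** The sets [G] whose indicator is a multiplier form a sigma-algebra containing the open rays that
    generate the Borel sets. *)
Lemma multiplier_indic (E : set R) : measurable E -> multiplier (fun x => (\1_E x)%:C%C).
Proof.
pose G := [set E : set R | measurable E /\ multiplier (fun x => (\1_E x)%:C%C)].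
have rayG : @RGenOInfty.G R `<=` G.
  move=> _ [a ->]; split => //.
  (* With $s$ the sign of $x-a$, the polynomial $(s^2+s)/2$ is 1 at $s=1$ and 0 at $s=0$ and $s=-1$,
     hence the indicator of $]a,+\infty[$. *)
  rewrite (_ : (fun _ => _) = (fun x => (2^-1)%:C%C *
     ((Num.sg (x - a))%:C%C * (Num.sg (x - a))%:C%C + (Num.sg (x - a))%:C%C))).
    have s := multiplier_sg_shift a.
    by apply: multiplierM; [exact: multiplier_cst|apply: multiplierD => //; exact: multiplierM].
  apply/funext => x; rewrite -!(rmorphM, rmorphD); congr (_%:C%C).
  rewrite indicE; have [xa|xa|->] := ltgtP x a.
  - by rewrite memNset ?ltr0_sg ?subr_lt0//=; [field|rewrite in_itv/= andbT ltNge ltW].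
  - by rewrite mem_set ?gtr0_sg ?subr_gt0//=; [field|rewrite in_itv/= andbT].
  - by rewrite memNset ?subrr ?sgr0 ?mulr0 ?addr0 ?mulr0//= in_itv/= ltxx.
have GC E' : G E' -> G (~` E').
  move=> [mE BE]; split; first exact: measurableC.
  rewrite (_ : (fun _ => _) = (fun x => 1 + (-1) * (\1_E' x)%:C%C)).
    by apply: multiplierD; [exact: multiplier_cst|apply: multiplierM => //; exact: multiplier_cst].
  by apply/funext => x; rewrite !indicE in_setC; case: (_ \in _); rewrite /= ?(rmorph0, rmorph1); ring.
have G0 : G set0.
  split => //; rewrite (_ : (fun _ => _) = (fun=> 0)); first exact: multiplier_cst.
  by apply/funext => x; rewrite indic0.
have GI E1 E2 : G E1 -> G E2 -> G (E1 `&` E2).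
  move=> [m1 B1] [m2 B2]; split; first exact: measurableI.
  rewrite (_ : (fun _ => _) = (fun x => (\1_E1 x)%:C%C * (\1_E2 x)%:C%C)); first exact: multiplierM.
  by apply/funext => x; rewrite indicI rmorphM.
have GU E1 E2 : G E1 -> G E2 -> G (E1 `|` E2).
  by move=> G1 G2; rewrite -[_ `|` _]setCK setCU; apply/GC/GI; exact: GC.
have GT : sigma_algebra setT G.
  split => //.
  - by move=> A /GC; rewrite setTD.
  - move=> A GA; split; first by apply: bigcup_measurable => k _; have [] := GA k.
    (* A countable union is reached through its finite partial unions, whose indicators are
       eventually constant at each point. *)
    have GAn n : G (\big[setU/set0]_(i < n) A i) by elim/big_ind : _ => //.
    apply: (@multiplier_lim (fun n x => \1_(\big[setU/set0]_(i < n) A i) x) _ 1).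
    + by move=> n; have [mA _] := GAn n; exact: measurable_indic.
    + by move=> n x; rewrite indicE; case: (_ \in _); rewrite ?normr1 ?normr0.
    + move=> x; apply: cvg_near_cst.
      have [[k _ Akx]|nA] := pselect ((\bigcup_k A k) x).
        near=> n; rewrite !indicE !mem_set//; first by exists k.
        rewrite -bigcup_mkord; exists k => //=.
        by near: n; exact: nbhs_infty_gt.
      apply: nearW => n; rewrite !indicE !memNset//.
      by rewrite -bigcup_mkord => -[k _ Akx]; apply: nA; exists k.
    + by move=> n; have [] := GAn n.
move=> mE; suff : G E by case.
have : (@RGenOInfty.G R).-sigma.-measurable E by rewrite -RGenOInfty.measurableE.
by apply: smallest_sub.
Unshelve. all: by end_near. Qed.

End MultiplierAlgebra.

(** * Bounded Borel functions as multipliers *)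

Section Commutant.
Variable R : realType.
Local Notation C := R[i].
Local Notation leb := (@lebesgue_measure R).
Variable B : opL2 R.
Hypothesis bB : bounded_op B.
Hypothesis BD : commutes B (@half_dil_op R).
Hypothesis Be : commutes B (mult_op (fun x => expmi (1 * x))).
Implicit Types (f g : R -> C) (u : R -> R).

Lemma multiplier_sum_indic (s : seq R) (E : R -> set R) :
  (forall r, measurable (E r)) ->
  multiplier B (fun x => (\sum_(r <- s) r * \1_(E r) x)%:C%C).
Proof.
move=> mE; elim: s => [|r s IH].
  rewrite (_ : (fun _ => _) = (fun=> 0)); first exact: multiplier_cst.
  by apply/funext => x; rewrite big_nil.
rewrite (_ : (fun _ => _) =
  (fun x => r%:C%C * (\1_(E r) x)%:C%C + (\sum_(r <- s) r * \1_(E r) x)%:C%C)).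
  apply: multiplierD => //; apply: multiplierM; first exact: multiplier_cst.
  exact: multiplier_indic.
by apply/funext => x; rewrite big_cons rmorphD rmorphM.
Qed.

Import HBNNSimple.

Lemma multiplier_bounded u : bounded_measurable u -> multiplier B (fun x => (u x)%:C%C).
Proof.
move=> [mu [K uK]].
(* Adding $K$ makes the function nonnegative, so that it is a limit of simple functions bounded by
   $2K$; the constant is subtracted at the end. *)
have mv : measurable_fun setT (EFin \o (fun x => u x + K)).
  by apply: measurable_EFin; exact: measurable_funD.
have v0 x : 0 <= u x + K by have := uK x; rewrite ler_norml => /andP[? _]; lra.
have v2 x : u x + K <= K + K by have := uK x; rewrite ler_norml => /andP[_ ?]; lra.
pose a := nnsfun_approx measurableT mv.
have a0 n x : 0 <= a n x by [].
have av n x : a n x <= u x + K.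
  rewrite -lee_fin /a nnsfun_approxE.
  by apply: (@le_approx _ _ R setT (EFin \o (fun x => u x + K))) => // y _; rewrite lee_fin.
have Bv : multiplier B (fun x => (u x + K)%:C%C).
  apply: (@multiplier_lim _ _ bB (fun n => a n) _ (K + K)).
  - by move=> n; exact: measurable_funPT.
  - by move=> n x; rewrite ger0_norm// (le_trans (av n x)).
  - move=> x; have : (EFin \o a^~ x) @ \oo --> (u x + K)%:E.
      by apply: cvg_nnsfun_approx => // y _; rewrite lee_fin.
    by move=> /fine_cvgP[_].
  - move=> n; rewrite (_ : (fun _ => _) = (fun x =>
      (\sum_(r <- finmap.enum_fset (fset_set (range (a n)))) r * \1_(a n @^-1` [set r]) x)%:C%C)).
      by apply: multiplier_sum_indic.
    by apply/funext => x; rewrite [in LHS]fimfunE fsbig_finite.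
rewrite (_ : (fun _ => _) = (fun x => (u x + K)%:C%C + (- K)%:C%C)).
  by apply: multiplierD => //; exact: multiplier_cst.
by apply/funext => x; rewrite -rmorphD/= addrK.
Qed.

(** * The symbol of a commuting operator, its boundedness and its invariance *)

Definition gauss (x : R) : R := Num.sqrt (normal_pdf 0 1 x).

Lemma gauss_gt0 x : 0 < gauss x.
Proof.
rewrite sqrtr_gt0 normal_pdfE ?oner_eq0// mulr_gt0 ?expR_gt0//.
by rewrite normal_peak_gt0// oner_eq0.
Qed.

Lemma gauss_sqr x : gauss x ^+ 2 = normal_pdf 0 1 x.
Proof. by rewrite sqr_sqrtr// normal_pdf_ge0. Qed.

Lemma measurable_gauss : measurable_fun setT gauss.
Proof.
apply: measurableT_comp (measurable_normal_pdf _ _).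
exact: continuous_measurable_fun (@sqrt_continuous R).
Qed.

Definition cgauss x : C := (gauss x)%:C%C.

(** The square root in [gauss] makes its squared norm the total mass 1 of the normal density. *)
Lemma isL2_gauss : isL2 cgauss.
Proof.
split; first exact: measC_real measurable_gauss.
rewrite (_ : (\int[leb]_x _)%E = 1%E) ?ltry//.
rewrite -[RHS](integral_normal_pdf 0 1); apply: eq_integral => x _.
by rewrite /cgauss cabs2_real gauss_sqr.
Qed.

Lemma measurable_inv u : measurable_fun setT u -> (forall x, 0 <= u x) ->
  measurable_fun setT (fun x => (u x)^-1).
Proof.
move=> mu u0; rewrite (_ : (fun x => (u x)^-1) = (fun x => u x `^ (-1))).
  exact: measurableT_comp (measurable_powR _) mu.
by apply/funext => x; rewrite powR_inv1.
Qed.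

(** A multiplication operator sends [cgauss] to its symbol times [cgauss], so this quotient is the
    only candidate up to null sets. *)
Definition symbol x : C := (gauss x)^-1%:C%C * B cgauss x.

Lemma measC_symbol : measC symbol.
Proof.
apply: measCM; last by have [] := isL2_op bB isL2_gauss.
apply: measC_real; apply: measurable_inv measurable_gauss _ => x.
exact/ltW/gauss_gt0.
Qed.

Lemma B_cgauss x : B cgauss x = symbol x * cgauss x.
Proof.
rewrite /symbol /cgauss mulrAC -rmorphM mulVf ?rmorph1 ?mul1r//.
exact/lt0r_neq0/gauss_gt0.
Qed.

(* With [w := gauss + |Re f| + |Im f|] both [gauss / w] and [f / w] are bounded,
   so [(gauss / w) B f = B ((f / w) gauss) = (f / w) B gauss]. *)
Lemma commutant_mult_op : op_eq B (mult_op symbol).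
Proof.
move=> f f2; have [[m1 m2] _] := f2.
pose w x := gauss x + (`|complex.Re (f x)| + `|complex.Im (f x)|).
have gw x : gauss x <= w x by rewrite lerDl addr_ge0.
have w0 x : 0 < w x by exact: lt_le_trans (gauss_gt0 x) _.
have mw : measurable_fun setT w.
  apply: measurable_funD; first exact: measurable_gauss.
  by apply: measurable_funD; exact: measurableT_comp.
have mw' : measurable_fun setT (fun x => (w x)^-1).
  by apply: measurable_inv mw _ => x; exact: ltW.
have bw u : measurable_fun setT u -> (forall x, `|u x| <= w x) ->
    bounded_measurable (fun x => u x / w x).
  move=> mu uw; split; first exact: measurable_funM.
  exists 1 => x; rewrite normrM (gtr0_norm (x := (w x)^-1)) ?invr_gt0//.
  by rewrite ler_pdivrMr// mul1r.
have bgw : bounded_measurable (fun x => gauss x / w x).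
  apply: bw; first exact: measurable_gauss.
  by move=> x; rewrite gtr0_norm ?gauss_gt0.
have [rho_inf Brho] := multiplier_bounded bgw.
have Bre : multiplier B (fun x => (complex.Re (f x) / w x)%:C%C).
  apply/multiplier_bounded/bw => // x; rewrite /w addrCA lerDl addr_ge0//.
  exact/ltW/gauss_gt0.
have Bim : multiplier B (fun x => (complex.Im (f x) / w x)%:C%C).
  apply/multiplier_bounded/bw => // x; rewrite /w addrA lerDr addr_ge0//.
  exact/ltW/gauss_gt0.
have phiE x : (w x)^-1%:C%C * f x = (complex.Re (f x) / w x)%:C%C +
    Complex 0 1 * (complex.Im (f x) / w x)%:C%C.
  case: (f x) => p q; apply/eqP; rewrite eq_complex/=.
  by apply/andP; split; apply/eqP; ring.
have [_ /(_ _ isL2_gauss) Bphi] : multiplier B (fun x => (w x)^-1%:C%C * f x).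
  rewrite (_ : (fun _ => _) = (fun x => (complex.Re (f x) / w x)%:C%C +
    Complex 0 1 * (complex.Im (f x) / w x)%:C%C)); last exact/funext.
  by apply: multiplierD => //; apply: multiplierM => //; exact: multiplier_cst.
have E : mult_op (fun x => (w x)^-1%:C%C * f x) cgauss =
         mult_op (fun x => (gauss x / w x)%:C%C) f.
  by apply/funext => x; rewrite /mult_op /cgauss rmorphM/=; ring.
move: Bphi; rewrite /op_comp E; apply: ae_impl2 (Brho f f2) => x.
rewrite /op_comp => ->; rewrite /mult_op B_cgauss => Ex.
have gw0 : (gauss x / w x)%:C%C != 0 :> C.
  by rewrite fmorph_eq0 mulf_neq0 ?invr_eq0 ?lt0r_neq0 ?gauss_gt0.
by apply: (mulfI gw0); rewrite Ex /cgauss rmorphM/=; ring.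
Qed.

(** Let $E$ be the set where $|h|^2 > M$, with $h$ the symbol and $M$ the bound of [B]. Testing [B]
    on $1_E$ times the Gaussian forces the integral over $E$ of $(|h|^2 - M)$ times the squared
    Gaussian to be at most 0, so $E$ is null. *)
Lemma isLinf_symbol : isLinf symbol.
Proof.
split; first exact: measC_symbol.
have [M [M0 BM]] := bounded_op_bound bB; exists M.
have mh := measurable_cabs2 measC_symbol.
pose E := [set x | M < cabs2 (symbol x)].
have mE : measurable E.
  rewrite (_ : E = setT `&` (fun x => cabs2 (symbol x)) @^-1` `]M, +oo[).
    exact: mh.
  by apply/seteqP; split => x; rewrite /E /= in_itv/= andbT => // -[].
have m1 : measurable_fun setT (\1_E : R -> R) by exact: measurable_indic.
pose f x : C := (\1_E x)%:C%C * cgauss x.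
have f2 : isL2 f.
  apply: isL2_mulreal isL2_gauss; split => //.
  by exists 1 => x; rewrite indicE; case: (_ \in _); rewrite ?normr1 ?normr0.
have [mf _] := f2.
(* The squared modulus of [p] is the excess $|hf|^2 - M|f|^2$; working with its norm turns a
   difference of integrals into the sum in [sumE]. *)
pose p x : C := (Num.sqrt (\1_E x * (cabs2 (symbol x) - M)))%:C%C * cgauss x.
have pE x : cabs2 (p x) = \1_E x * (cabs2 (symbol x) - M) * gauss x ^+ 2.
  rewrite cabs2M !cabs2_real sqr_sqrtr// indicE.
  have [|_] := boolP (x \in E); last by rewrite mul0r.
  by rewrite inE /E /= mul1r subr_ge0 => /ltW.
have mp : measC p.
  apply: measCM (measC_real measurable_gauss); apply: measC_real.
  apply: measurableT_comp; first exact: continuous_measurable_fun (@sqrt_continuous R).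
  by apply: measurable_funM => //; exact: measurable_funB.
have sumE : (sqnorm p + M%:E * sqnorm f = sqnorm (B f))%E.
  have -> : sqnorm (B f) = sqnorm (mult_op symbol f).
    apply: aeeq_sqnorm (commutant_mult_op f2).
      by have [] := isL2_op bB f2.
    exact: measCM measC_symbol mf.
  rewrite /sqnorm -ge0_integralZl//; last 2 first.
  - exact: measurable_cabs2_EFin mf.
  - by move=> x _; rewrite lee_fin cabs2_ge0.
  rewrite -ge0_integralD//; last 4 first.
  - by move=> x _; rewrite lee_fin cabs2_ge0.
  - exact: measurable_cabs2_EFin mp.
  - by move=> x _; rewrite -EFinM lee_fin mulr_ge0// cabs2_ge0.
  - apply: (@measurable_EFin _ (fun x => M * cabs2 (f x))).
    by apply: measurable_funM => //; exact: measurable_cabs2 mf.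
  apply: eq_integral => x _; rewrite -EFinM -EFinD; congr (_%:E).
  rewrite pE /mult_op /f !cabs2M !cabs2_real indicE.
  by case: (_ \in _); rewrite /=; ring.
have p0 : (sqnorm p <= 0)%E.
  have := BM f f2; rewrite -sumE.
  have := sqnorm_fin f2; have := sqnorm_ge0 p.
  case: (sqnorm f) => [q||] //; case: (sqnorm p) => [q'||] //= _ _.
  by rewrite -EFinM -EFinD !lee_fin gerDr.
apply: ae_impl (sqnorm_eq0 mp p0) => x px.
rewrite leNgt; apply/negP => Mx.
have := pE x; rewrite px indicE mem_set// mul1r /cabs2 /= expr0n/= addr0.
move=> /esym/eqP; rewrite mulf_eq0 subr_eq0 (gt_eqF Mx)/= expf_eq0/=.
by rewrite gt_eqF// gauss_gt0.
Qed.

(** Evaluate the commutation with [half_dil_op] on the Gaussian. The dilated Gaussian vanishes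
    nowhere, so cancelling it leaves $h(s) = h(s/2)$, and replacing $s$ by $2s$ concludes. *)
Lemma symbol_dil : {ae leb, forall s, symbol s = symbol (2 * s)}.
Proof.
have Dg2 := isL2_op (bounded_half_dil_op R) isL2_gauss.
have H : {ae leb, forall s, symbol s = symbol (2^-1 * s + 0)}.
  apply: ae_impl2 (commutant_mult_op Dg2) (BD isL2_gauss) => x.
  rewrite /op_comp => ->; rewrite /mult_op /half_dil_op B_cgauss.
  rewrite mulrA [symbol x * _]mulrC -mulrA => E.
  have s0 : (Num.sqrt 2 / 2)%:C%C != 0 :> C.
    by rewrite fmorph_eq0 mulf_neq0 ?invr_eq0 ?gt_eqF ?sqrtr_gt0.
  have g0 : cgauss (2^-1 * x + 0) != 0 by rewrite fmorph_eq0 gt_eqF// gauss_gt0.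
  exact: (mulIf g0 (mulfI s0 E)).
have := ae_affine 0 (ltr0Sn _ 1 : 0 < 2 :> R) H.
apply: ae_impl => x; rewrite !addr0 mulrA mulVf ?mul1r ?pnatr_eq0//.
Qed.

End Commutant.

(** * The commutant of the conjugated dilation and translation *)

Theorem theorem6 (R : realType) (F Finv : opL2 R) :
  is_fourier_plancherel F -> is_inverse_op F Finv ->
  let Dh := op_comp F (op_comp (@dil_op R) Finv) in
  let Th := op_comp F (op_comp (@transl_op R) Finv) in
  (forall B : opL2 R, bounded_op B -> commutes B Dh -> commutes B Th ->
     exists h : R -> R[i], [/\ isLinf h,
        {ae @lebesgue_measure R, forall s, h s = h (2 * s)} &
        op_eq B (mult_op h)]) /\
  (forall h : R -> R[i], isLinf h ->
     {ae @lebesgue_measure R, forall s, h s = h (2 * s)} ->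
     [/\ bounded_op (mult_op h), commutes (mult_op h) Dh & commutes (mult_op h) Th]).
Proof.
move=> FP Finv_inv Dh Th; have [bF _] := FP; have [bFinv _] := Finv_inv.
have bD := bounded_half_dil_op R.
have bE := bounded_mult_op (isLinf_expmi (1 : R)).
have bDh : bounded_op Dh.
  exact: bounded_op_comp bF (bounded_op_comp (bounded_dil_op R) bFinv).
have bTh : bounded_op Th.
  exact: bounded_op_comp bF (bounded_op_comp (bounded_transl_op R) bFinv).
(* From here on both inclusions concern only [half_dil_op] and the multiplication by $e^{-is}$. *)
have DhE : op_eq Dh (@half_dil_op R) := conjugate_op_eq bF Finv_inv bD (fourier_dil FP).
have ThE : op_eq Th (mult_op (fun s => expmi (1 * s))) :=
  conjugate_op_eq bF Finv_inv bE (fourier_transl FP).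
split=> [B bB BDh BTh|h hinf h2].
  have BD := commutes_congr bDh bD bB DhE BDh.
  have Be := commutes_congr bTh bE bB ThE BTh.
  exists (symbol B); split.
  - exact: isLinf_symbol.
  - exact: symbol_dil.
  - exact: commutant_mult_op.
have bh := bounded_mult_op hinf.
have op_eq_sym (A A' : opL2 R) : op_eq A A' -> op_eq A' A.
  by move=> AA f f2; exact/aeeq_sym/AA.
split=> //.
- apply: (commutes_congr bD bDh bh (op_eq_sym _ _ DhE)) => f _.
  have h0 : 0 < 2^-1 :> R by rewrite invr_gt0.
  (* The invariance taken at $x/2$ gives $h(x/2) = h(x)$, which is what commutation with the
     dilation by $1/2$ requires. *)
  apply: ae_impl (ae_affine 0 h0 h2) => x.
  rewrite /op_comp /mult_op /half_dil_op !addr0 mulrA divff ?pnatr_eq0// mul1r => ->.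
  by rewrite mulrCA.
- apply: (commutes_congr bE bTh bh (op_eq_sym _ _ ThE)) => f _.
  by apply: aeW => x; rewrite /op_comp /mult_op mulrCA.
Qed.
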